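(* Let $G$ be a connected simple graph with $\chi(G)=3$ whose vertex set is partitioned into three independent sets $V_1=\{w\}$, $V_2=\{u_1,\ldots,u_x\}$ with $x\ge 2$, and $V_3=\{v_1,\ldots,v_y\}$ with $y\ge 2$, such that $w$ is adjacent to exactly $2a+1$ vertices of $V_2$ and exactly $2b+1$ vertices of $V_3$ for some integers $a,b\ge 0$, every vertex of $V_2$ has degree $2m$, and every vertex of $V_3$ has degree $2n$ (for some positive integers $m,n$). Then for every integer $t\ge 3$, $\chi_{la}(G[O_t])=3$.
   Context: For a graph $G=(V,E)$ with $q$ edges, a bijection $f:E\to\{1,\ldots,q\}$ is a local antimagic labeling if $f^+(u)\ne f^+(v)$ for all adjacent $u,v$, where $f^+(u)$ is the sum of labels of edges incident to $u$. $\chi_{la}(G)$ is the minimum number of distinct values of $f^+$ over all local antimagic labelings of $G$; $\chi(G)$ is the chromatic number. $O_t$ is the edgeless graph on $t$ vertices; $G[H]$ is the lexicographic product: vertex set $V(G)\times V(H)$, with $(u,u')\sim(v,v')$ iff $uv\in E(G)$, or $u=v$ and $u'v'\in E(H)$. *)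

(* Defs.v *)
From mathcomp Require Import all_boot.

Set Implicit Arguments.
Unset Strict Implicit.
Unset Printing Implicit Defensive.

Record sgraph := SGraph {
  svertex :> finType;
  adj : rel svertex;
  adj_sym : symmetric adj;
  adj_irr : irreflexive adj
}.

Section GraphNotions.
Variable G : sgraph.
Implicit Types (u v : G) (A : {set G}).

Definition neighbors u : {set G} := [set v | adj u v].

Definition degree u : nat := #|neighbors u|.

Definition connected_graph : Prop := forall u v, connect (@adj G) u v.

Definition independent A : Prop := {in A &, forall u v, ~~ adj u v}.

Definition proper_coloring (k : nat) (c : G -> 'I_k) : Prop :=
  forall u v, adj u v -> c u != c v.

(* An edge is the two-element set of its endpoints. *)
Definition edges : {set {set G}} :=
  [set [set u; v] | u in [set: G], v in neighbors u].

(* Labels are given on all sets of vertices; only the values of f on [edges]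
   are constrained or used. *)
Definition edge_labeling (f : {set G} -> nat) : Prop :=
  {in edges &, injective f} /\
  (forall k : nat, (exists2 e, e \in edges & f e = k) <-> 1 <= k <= #|edges|).

Definition vertex_sum (f : {set G} -> nat) u : nat :=
  \sum_(e in edges | u \in e) f e.

Definition local_antimagic (f : {set G} -> nat) : Prop :=
  edge_labeling f /\
  (forall u v, adj u v -> vertex_sum f u <> vertex_sum f v).

Definition num_colors (f : {set G} -> nat) : nat :=
  size (undup [seq vertex_sum f u | u : G]).

End GraphNotions.

Definition is_minimum (P : nat -> Prop) (k : nat) : Prop :=
  P k /\ (forall j, P j -> k <= j).

Definition is_chromatic_number (G : sgraph) : nat -> Prop :=
  is_minimum (fun k => exists c : G -> 'I_k, proper_coloring c).

(* A relation rather than a function: a graph with a K_2 component has no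
   local antimagic labeling, and then no k is related to it. *)
Definition is_local_antimagic_chromatic_number (G : sgraph) : nat -> Prop :=
  is_minimum
    (fun k => exists f : {set G} -> nat, local_antimagic f /\ num_colors f = k).

Section EdgelessGraph.
Variable t : nat.

Definition edgeless_adj : rel 'I_t := fun _ _ => false.

Fact edgeless_adj_sym : symmetric edgeless_adj. Proof. by []. Qed.

Fact edgeless_adj_irr : irreflexive edgeless_adj. Proof. by []. Qed.

Definition edgeless : sgraph := SGraph edgeless_adj_sym edgeless_adj_irr.

End EdgelessGraph.

Section LexicographicProduct.
Variables G H : sgraph.

Definition lex_adj : rel (G * H) := fun p q =>
  adj p.1 q.1 || (p.1 == q.1) && adj p.2 q.2.

Fact lex_adj_sym : symmetric lex_adj.
Proof. by move=> p q; rewrite /lex_adj adj_sym eq_sym (adj_sym p.2). Qed.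

Fact lex_adj_irr : irreflexive lex_adj.
Proof. by move=> p; rewrite /lex_adj !adj_irr andbF. Qed.

Definition lex_product : sgraph := SGraph lex_adj_sym lex_adj_irr.

End LexicographicProduct.

(* Main.v *)
Require Import Defs.
From mathcomp Require Import all_boot.
From mathcomp Require Import zify.

(* Split w into w2 (joined to V2) and w3 (joined to V3).  The resulting graph is
   bipartite and w2, w3 are its only vertices of odd degree, so its edges form
   a single trail e_0, ..., e_{q-1} from w2 to w3, with q odd.  Giving the
   edges the weights 0, q-1, 1, q-2, ... along the trail, consecutive edges add
   up to q-1 at the vertices of V2 and w3, and to q at those of w2 and V3, so
   vertices of the same class get the same weight.

   In G[O_t] the edge e_k becomes a copy of K_{t,t}, labeled by t^2 times the
   weight of e_k plus a t x t square M or its complement, alternately.  The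
   complements cancel at each pair of consecutive edges, so all copies of a
   vertex get the same sum except perhaps for w, where the row of the first
   block meets the column of the last one; it thus suffices that row i plus
   column i of M does not depend on i.  Such an M exists for all t >= 3.

   The lower bound holds because the sums properly color the copy
   u -> (u, 0) of G in G[O_t]. *)

Set Implicit Arguments.
Unset Strict Implicit.
Unset Printing Implicit Defensive.

(** * Squares with constant row plus column sums *)

(** The first two clauses make the entries a permutation of 0, ..., t^2 - 1. All row plus column
    sums then total t^2 (t^2 - 1), which forces the constant. *)
Definition balanced_square t (M : nat -> nat -> nat) : Prop :=
  [/\ forall i j, i < t -> j < t -> M i j < t ^ 2,
      forall i j i' j', i < t -> j < t -> i' < t -> j' < t ->
        M i j = M i' j' -> i = i' /\ j = j' &
      forall i, i < t -> \sum_(j < t) (M i j + M j i) = t * (t ^ 2).-1].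

(* In labels centred at 0 ([c] is then negation), off the diagonal the new
   cells come in antisymmetric pairs, which leave every row-plus-column sum
   alone.  Only the cells of the new indices t, t+1 on the diagonal and
   against index 0 differ: the diagonal carries d and -d, compensated at index
   0 by -(d-1), -(d+1) and d-1, d+1. *)
Definition bordered_square t (M : nat -> nat -> nat) i j : nat :=
  let c x := (t.+2 ^ 2).-1 - x in
  if (i < t) && (j < t) then M i j + t.*2.+2
  else if j < t then
    if j == 0 then (if i == t then 2 else c 2)
    else (if i == t then c j.*2.+1 else c j.*2.+2)
  else if i < t then
    if i == 0 then (if j == t then 0 else c 0)
    else (if j == t then i.*2.+1 else i.*2.+2)
  else if i == t then (if j == t then c 1 else t.*2.+1)
  else (if j == t then c t.*2.+1 else 1).

(** The old entries move to 2t+2, ..., t^2+2t+1, while the border takes each of 0, ..., 2t+1 and its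
    complement exactly once, so no value repeats. *)
Lemma balanced_bordered t M : 0 < t ->
  balanced_square t M -> balanced_square t.+2 (bordered_square t M).
Proof.
move=> t_gt0 [Mlt Minj Msum].
have sqE : t.+2 ^ 2 = t ^ 2 + 4 * t + 4 by lia.
split.
- move=> i j lti ltj; rewrite /bordered_square sqE.
  case: (ltnP i t) => hi; case: (ltnP j t) => hj /=.
  + by have := Mlt _ _ hi hj; lia.
  + by repeat (case: eqP => ? /=); lia.
  + by repeat (case: eqP => ? /=); lia.
  + by repeat (case: eqP => ? /=); lia.
{ move=> i j i' j' lti ltj lti' ltj'; rewrite /bordered_square sqE.
  have tt : t <= t ^ 2 by nia.
  case: (ltnP i t) => hi; case: (ltnP j t) => hj /=;
  case: (ltnP i' t) => hi'; case: (ltnP j' t) => hj' /=.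
  + by move/addIn; apply: Minj.
  all: try (have := Mlt _ _ hi hj); try (have := Mlt _ _ hi' hj').
  all: by repeat (case: eqP => ? /=); lia. }

move=> i lti; rewrite !big_ord_recr sqE /=.
have [hi|hi] := ltnP i t.
  rewrite (eq_bigr (fun j : 'I_t => (M i j + M j i) + t.*2.+2.*2)); last first.
    by move=> j _; rewrite /bordered_square !hi !ltn_ord /=; lia.
  rewrite big_split /= Msum // sum_nat_const card_ord /bordered_square.
  rewrite sqE hi !ltnn (ltnNge t.+1 t) leqnSn /=.
  have tt : t <= t ^ 2 by nia.
  have -> : (t.+1 == t) = false by lia.
  rewrite eqxx; case: (posnP i) => [_|i0]; first by nia.
  by nia.
have tt : t <= t ^ 2 by nia.
have t1 : (t.+1 == t) = false by lia.
(* Mirrored cells have the usual sum except at index 0, where they are 2 and 0 or the complements of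
   these, hence off by t^2+4t+1. The diagonal cell, counted twice, offsets this. *)
have rowE (j : 'I_t) : bordered_square t M i j + bordered_square t M j i =
    (t ^ 2 + 4 * t + 3) -
    (j == 0 :> nat) * (if i == t then (t ^ 2 + 4 * t + 1) else 0) +
    (j == 0 :> nat) * (if i == t then 0 else (t ^ 2 + 4 * t + 1)).
  rewrite /bordered_square sqE ltn_ord; have ltj := ltn_ord j.
  rewrite !(ltnNge i t) hi /=.
  case: (val j) ltj => [|k] ltk /=; case: (i == t); lia.
rewrite (eq_bigr _ (fun j _ => rowE j)).
case: t t_gt0 lti hi {Mlt Minj Msum} sqE tt t1 rowE => // t _ lti hi sqE tt t1 _.
rewrite big_ord_recl /= (eq_bigr (fun=> t.+1 ^ 2 + 4 * t.+1 + 3)); last first.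
  by move=> j _ /=; rewrite !mul0n; lia.
rewrite sum_nat_const card_ord /bordered_square sqE.
have [->|->] : i = t.+1 \/ i = t.+2 by lia.
  by rewrite !ltnn !(ltnNge t.+2) leqnSn /= !eqxx t1; nia.
by rewrite !ltnn !(ltnNge t.+2) leqnSn /= !eqxx t1; nia.
Qed.

(* The induction on even sizes starts at 4: no such square of size 2 exists. *)
Lemma balanced_square4 :
  balanced_square 4 (fun i j => nth 0 (nth [::] [:: [:: 8; 12; 11; 14];
    [:: 2; 9; 10; 15]; [:: 4; 3; 7; 13]; [:: 1; 0; 5; 6]] i) j).
Proof.
split.
- by case=> [|[|[|[|i]]]] [|[|[|[|j]]]].
{ move=> i j i' j' lti ltj lti' ltj' /= E.
  case: i j lti ltj E => [|[|[|[|i]]]] [|[|[|[|j]]]] // _ _.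
  all: by case: i' j' lti' ltj' => [|[|[|[|i']]]] [|[|[|[|j']]]]. }
by case=> [|[|[|[|i]]]] // _; rewrite !big_ord_recr big_ord0.
Qed.

Lemma balanced_squareP t : 3 <= t -> exists M, balanced_square t M.
Proof.
have step u : 0 < u -> (exists M, balanced_square u M) ->
    exists M, balanced_square u.+2 M.
  by move=> u0 [M /(balanced_bordered u0)]; exists (bordered_square u M).
have odd_case k : exists M, balanced_square k.*2.+1 M.
  elim: k => [|k IHk]; last exact: step.
  exists (fun _ _ => 0); split=> [||i _]; try by move=> *; lia.
  by rewrite big_ord_recr big_ord0.
have even_case k : exists M, balanced_square k.*2.+4 M.
  elim: k => [|k IHk]; last exact: step.
  exact: ex_intro balanced_square4.
move=> t3; have [ot|et] := boolP (odd t).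
  by rewrite -(odd_double_half t) ot; apply: odd_case.
have -> : t = (t./2 - 2).*2.+4 by lia.
exact: even_case.
Qed.

(** * Eulerian trails *)

Section Euler.
Variable G : sgraph.
Implicit Types (s u v x y z : G) (p : seq G).

Definition walk_edges x p : seq {set G} :=
  pairmap (fun u v => [set u; v]) x p.

Lemma edgesP (e : {set G}) :
  reflect (exists u v, adj u v /\ e = [set u; v]) (e \in edges G).
Proof.
apply: (iffP imset2P) => [[u v _]|[u [v [uv ->]]]].
  by rewrite inE => uv ->; exists u, v.
by exists u v; rewrite ?inE.
Qed.

Lemma adj_edge u v : adj u v -> [set u; v] \in edges G.
Proof. by move=> uv; apply/edgesP; exists u, v. Qed.

Lemma set2_injr u v v' : [set u; v] = [set u; v'] -> v = v'.
Proof.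
move=> E; have := set22 u v'; rewrite -E !inE => /orP[]/eqP // vu.
by have := set22 u v; rewrite E vu !inE orbb => /eqP.
Qed.

Lemma degreeE u : degree u = #|[set e in edges G | u \in e]|.
Proof.
rewrite /degree -(card_imset _ (@set2_injr u)); apply: eq_card => e.
rewrite inE; apply/imsetP/andP => [[v]|[/edgesP[x [y [xy ->]]]]].
  by rewrite inE => uv ->; rewrite adj_edge ?set21.
rewrite !inE => /orP[]/eqP->; first by exists y; rewrite ?inE.
by exists x; rewrite 1?setUC // inE adj_sym.
Qed.

Lemma walk_edges_sub x p : path (@adj G) x p ->
  {subset walk_edges x p <= edges G}.
Proof.
elim: p x => //= y p IHp x /andP[xy py] e; rewrite inE => /predU1P[->|].
  exact: adj_edge.
exact: IHp.
Qed.

Lemma walk_edges_cat x p p' :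
  walk_edges x (p ++ p') = walk_edges x p ++ walk_edges (last x p) p'.
Proof. exact: pairmap_cat. Qed.

Lemma mem_walk_edges x p e u : e \in walk_edges x p -> u \in e -> u \in x :: p.
Proof.
elim: p x => //= y p IHp x; rewrite inE => /predU1P[->|].
  by rewrite !inE => /orP[]->; rewrite ?orbT.
by move=> ep /(IHp _ ep) uyp; rewrite inE uyp orbT.
Qed.

(** Every inner visit of a vertex uses one edge in and one edge out, so only the two ends of the
    walk affect the parity. *)
Lemma odd_walk_degree x p u : path (@adj G) x p ->
  odd (count (fun e : {set G} => u \in e) (walk_edges x p)) =
    (u == x) (+) (u == last x p).
Proof.
elim: p x => [|y p IHp] x /=; first by rewrite addbb.
case/andP=> xy /IHp E; rewrite oddD E !inE; move: xy.
case: (eqVneq u x) => [<-|_]; case: (eqVneq u y) => [<-|_] //=.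
  by rewrite adj_irr.
by rewrite negbK.
Qed.

(** Applied where a trail gets stuck: all edges at [u] are then used, and the parity of the trail at
    [u] becomes that of its degree. *)
Lemma degree_covered (S : seq {set G}) u :
  {subset S <= edges G} -> uniq S -> (forall v, adj u v -> [set u; v] \in S) ->
  degree u = count (fun e : {set G} => u \in e) S.
Proof.
move=> sSE uS cov; rewrite degreeE -size_filter.
rewrite -(card_uniqP (filter_uniq _ uS)); apply: eq_card => e.
rewrite inE mem_filter andbC; apply: andb_id2l => ue.
apply/idP/idP; last exact: sSE.
case/edgesP=> x [y [xy eE]]; move: ue; rewrite eE !inE => /orP[]/eqP E.
  by rewrite -E cov // E.
by rewrite setUC -E cov // E adj_sym.
Qed.

(** Greedy extension, each edge taken being added to the forbidden set [U]. Besides serving the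
    induction, [U] lets a detour avoid a trail already built. *)
Lemma maximal_trail (U : {set {set G}}) s : exists p,
  [/\ path (@adj G) s p, uniq (walk_edges s p),
      {in walk_edges s p, forall e, e \notin U} &
      forall v, adj (last s p) v ->
        ([set last s p; v] \in U) || ([set last s p; v] \in walk_edges s p)].
Proof.
have [n] := ubnP #|~: U|; elim: n => // n IHn in U s *; rewrite ltnS => leUn.
have [/existsP[v /andP[sv svU]]|/existsPn noext] :=
  boolP [exists v, adj s v && ([set s; v] \notin U)]; last first.
  exists [::]; split=> //= v sv; rewrite orbF.
  by have := noext v; rewrite sv negbK.
have [|p [pp up dp mp]] := IHn ([set s; v] |: U) v.
  apply: leq_trans leUn; apply: proper_card.
  rewrite properC; apply/properP; split; first exact: subsetUr.
  by exists [set s; v]; rewrite ?setU11.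
exists (v :: p); split=> /=.
- by rewrite sv.
- by rewrite up andbT; apply/negP => /dp; rewrite setU11.
- move=> e; rewrite inE => /predU1P[->//|/dp].
  by rewrite !inE negb_or => /andP[].
by move=> v' /mp; rewrite !inE orbA (orbC (_ \in U)).
Qed.

(* Two possible starting vertices in the connectivity assumption spare a
   separate proof that the split graph below is connected. *)
Theorem euler_trail s z :
  odd (degree s) -> (forall v, odd (degree v) -> (v == s) || (v == z)) ->
  (forall v, connect (@adj G) s v || connect (@adj G) z v) ->
  exists p, [/\ path (@adj G) s p, last s p = z, uniq (walk_edges s p) &
                walk_edges s p =i edges G].
Proof.
move=> odds oddsz conn.
have [p0 [pp0 up0 _ mp0]] := maximal_trail set0 s.
(* The trail is stuck with all edges at its last vertex used. Were that vertex [s], its degree would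
   be even; so it is another vertex of odd degree. *)
have [lz neq_sz oddz] : [/\ last s p0 = z, s != z & odd (degree z)].
  have cov v : adj (last s p0) v -> [set last s p0; v] \in walk_edges s p0.
    by move/mp0; rewrite inE.
  have /(congr1 odd) := degree_covered (walk_edges_sub pp0) up0 cov.
  rewrite odd_walk_degree // eqxx addbT.
  have [E|ls] := eqVneq (last s p0) s; first by rewrite E odds.
  move=> odd_last; have := oddsz _ odd_last.
  by rewrite (negPf ls) => /eqP lz; rewrite -lz eq_sym.
have oddE v : odd (degree v) = (v == s) (+) (v == z).
  apply/idP/idP => [/oddsz|]; case: (eqVneq v s) => [->|_] //=.
  by move/eqP->.
have main n p : path (@adj G) s p -> last s p = z -> uniq (walk_edges s p) ->
    #|edges G| - size (walk_edges s p) < n ->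
    exists p, [/\ path (@adj G) s p, last s p = z, uniq (walk_edges s p) &
                walk_edges s p =i edges G].
  elim: n p => // n IHn p pp lp up ltn.
  have subE := walk_edges_sub pp.
  have [cov|] := boolP [forall e in edges G, e \in walk_edges s p].
    exists p; split=> // e; apply/idP/idP => [/subE//|eE].
    by move/forall_inP: cov; apply.
  case/forall_inPn=> e eE eU.
  have /existsP[x /andP[xp /existsP[y /andP[xy xyU]]]] :
      [exists x, (x \in s :: p) &&
        [exists y, adj x y && ([set x; y] \notin walk_edges s p)]].
    apply: contraNT eU => /existsPn no_exit.
    have used x y : x \in s :: p -> adj x y -> [set x; y] \in walk_edges s p.
      move=> xp xy; have := no_exit x; rewrite xp => /existsPn/(_ y).
      by rewrite xy negbK.
    have clos : closed (@adj G) (mem (s :: p)).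
      apply: intro_closed => [u v|u v uv up']; first exact/sym_connect_sym/adj_sym.
      by apply: mem_walk_edges (used _ _ up' uv) _; rewrite set22.
    have all_in v : v \in s :: p.
      have [/(closed_connect clos)|/(closed_connect clos)] := orP (conn v).
        by rewrite mem_head.
      by rewrite -lp mem_last.
    by case/edgesP: eE => u [v [uv ->]]; apply: used.
  have [p' [pp' up' dp' mp']] := maximal_trail [set e in walk_edges s p] x.
  have up_all : uniq (walk_edges s p ++ walk_edges x p').
    rewrite cat_uniq up up' andbT; apply/hasPn => e' /dp'.
    by rewrite inE.
  (* The trail alone already has the parity of the degree at every vertex, so a detour that is stuck
     must have returned to its start. *)
  have lx : last x p' = x.
    have sub_all : {subset walk_edges s p ++ walk_edges x p' <= edges G}.
      by move=> e'; rewrite mem_cat => /orP[/subE|/(walk_edges_sub pp')].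
    have cov v : adj (last x p') v ->
        [set last x p'; v] \in walk_edges s p ++ walk_edges x p'.
      by move/mp'; rewrite inE mem_cat.
    have /(congr1 odd) := degree_covered sub_all up_all cov.
    rewrite count_cat oddD !odd_walk_degree // lp eqxx addbT oddE.
    by do 3!case: eqP.
  have szp' : 0 < size p'.
    case: p' lx mp' {pp' up' dp' up_all} => //= _ /(_ y xy).
    by rewrite inE orbF (negPf xyU).
  case/splitPl: xp pp lp subE up_all ltn => p1 p2 lp1.
  rewrite cat_path last_cat lp1 => /andP[pp1 pp2] lp2 subE up_all ltn.
  have perm_new : perm_eq (walk_edges s (p1 ++ p' ++ p2))
                          (walk_edges s (p1 ++ p2) ++ walk_edges x p').
    by rewrite !walk_edges_cat lp1 lx -catA perm_cat2l perm_catC.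
  apply: (IHn (p1 ++ p' ++ p2)).
  - by rewrite !cat_path pp1 lp1 pp' lx.
  - by rewrite !last_cat lp1 lx.
  - by rewrite (perm_uniq perm_new).
  rewrite (perm_size perm_new) size_cat.
  have szE : size (walk_edges x p') = size p' by rewrite size_pairmap.
  have : size (walk_edges s (p1 ++ p2)) + size (walk_edges x p') <= #|edges G|.
    rewrite -size_cat.
    rewrite -(card_uniqP up_all); apply: subset_leq_card.
    by apply/subsetP=> e'; rewrite mem_cat => /orP[/subE|/(walk_edges_sub pp')].
  move: szp' ltn; rewrite -szE; move: #|_| (size _) (size _); clear.
  by move=> E a b; lia.
by apply: (main _ p0 pp0 lz up0 (ltnSn _)).
Qed.
End Euler.

(** * Labeling G[O_t] along an Eulerian trail of G *)

(** An injection into as many values as there are indices hits all of them. Labels are counted from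
    0 on [I], hence the successor. *)
Lemma edge_labeling_of_param (G : sgraph) (I : finType) (em : I -> {set G})
    (l : I -> nat) :
  injective em -> (forall e, e \in edges G <-> exists i, e = em i) ->
  injective l -> (forall i, l i < #|I|) ->
  exists f : {set G} -> nat, edge_labeling f /\
    forall u, vertex_sum f u = \sum_(i | u \in em i) (l i).+1.
Proof.
move=> em_inj em_onto l_inj l_lt.
pose f e := if [pick i | em i == e] is Some i then (l i).+1 else 0.
have fE i : f (em i) = (l i).+1.
  rewrite /f; case: pickP => [j /eqP/em_inj -> //|/(_ i)].
  by rewrite eqxx.
have edgesE : edges G = em @: [set: I].
  apply/setP=> e; apply/idP/imsetP => [/em_onto[i ->]|[i _ ->]].
    by exists i.
  by apply/em_onto; exists i.
have card_edges : #|edges G| = #|I|.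
  by rewrite edgesE card_imset // cardsT.
exists f; split; [split|].
- by move=> e e' /em_onto[i ->] /em_onto[j ->]; rewrite !fE => -[/l_inj->].
- move=> k; rewrite card_edges; split => [[_ /em_onto[i ->] <-]|].
    by rewrite fE; apply: l_lt.
  case: k => // k /= ltk.
  pose li i := Ordinal (l_lt i).
  have [i [->]] : exists i, Ordinal ltk = li i.
    by apply/codomP/inj_card_onto; rewrite ?card_ord // => i j [/l_inj].
  exists (em i); rewrite ?fE //.
  by apply/em_onto; exists i.
move=> u; rewrite /vertex_sum edgesE.
rewrite (eq_bigl (fun e => (e \in em @: [set i | u \in em i]))).
  rewrite big_imset /=; last by move=> i j _ _ /em_inj.
  by apply: eq_big => [i|i _]; rewrite ?inE ?fE.
move=> e; apply/andP/imsetP => [[/imsetP[i _ ->] ui]|[i]].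
  by exists i; rewrite ?inE.
by rewrite inE => ui ->; rewrite imset_f.
Qed.

Lemma set2_eq (T : finType) (a b c d : T) : [set a; b] = [set c; d] ->
  (a = c /\ b = d) \/ (a = d /\ b = c).
Proof.
move=> E.
have := set21 a b; have := set22 a b; rewrite {1 2}E.
have := set21 c d; have := set22 c d; rewrite -{1 2}E !inE.
by do 4!case/orP=> /eqP ?; subst; auto.
Qed.

(** Regroups a sum over the edges of a trail by positions: an inner position ends one edge and
    starts the next, while 0 and [q] belong to a single edge. *)
Lemma sum_shift (q : nat) (A B : nat -> nat) : 0 < q ->
  \sum_(k < q) (A k + B k.+1) = A 0 + \sum_(1 <= p < q) (A p + B p) + B q.
Proof.
case: q => // q _; rewrite !big_split /= big_ord_recl big_ord_recr /=.
rewrite !big_add1 !big_mkord /=.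
rewrite (eq_bigr (fun i : 'I_q => A i.+1)) //.
lia.
Qed.

Lemma eqn_divmod d a b a' b' : b < d -> b' < d ->
  a * d + b = a' * d + b' -> a = a' /\ b = b'.
Proof.
move=> ltb ltb' E; have d0 : 0 < d by apply: leq_trans ltb.
have := congr1 (divn^~ d) E; have := congr1 (modn^~ d) E.
by rewrite /= !modnMDl !divnMDl // !modn_small // !divn_small // !addn0.
Qed.

Section LexLabeling.
Variables (G : sgraph) (t q : nat) (x : nat -> G) (M : nat -> nat -> nat).
Hypotheses (odd_q : odd q) (Mbal : balanced_square t M).

(* The k-th edge of the trail becomes a t x t block of edges of G[O_t].  Its
   rows are the copies of the endpoint in even position, so that the two blocks
   meeting at an inner position p share rows (p even) or columns (p odd). *)
Definition row_end k := if odd k then x k.+1 else x k.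
Definition col_end k := if odd k then x k else x k.+1.

Hypothesis adj_ends : forall k, k < q -> adj (row_end k) (col_end k).
Hypothesis ends_inj : forall k k', k < q -> k' < q ->
  row_end k = row_end k' -> col_end k = col_end k' -> k = k'.
Hypothesis ends_noswap : forall k k', k < q -> k' < q ->
  row_end k = col_end k' -> col_end k <> row_end k'.
Hypothesis ends_onto : forall u v, adj u v -> exists2 k, k < q &
  (u = row_end k /\ v = col_end k) \/ (v = row_end k /\ u = col_end k).

(* Values 0, q-1, 1, q-2, ...: two consecutive ones add up to q-1 or to q,
   according to the parity of the position between them. *)
Definition block k := if odd k then q.-1 - k./2 else k./2.

(* Consecutive blocks use complementary squares, so the row and column sums of
   [M] only matter at the two ends of the trail. *)
Definition cell k i j := if odd k then (t ^ 2).-1 - M i j else M i j.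

(** Two digits in base t^2, counted from 0; the shift by one comes with the sums. *)
Definition lex_label k i j := block k * t ^ 2 + cell k i j.

Lemma block_lt k : k < q -> block k < q.
Proof. by rewrite /block; case: ifP; lia. Qed.

Lemma block_inj k k' : k < q -> k' < q -> block k = block k' -> k = k'.
Proof. by rewrite /block; do 2!case: ifP; lia. Qed.

Lemma block_sum p : 0 < p < q -> block p.-1 + block p = if odd p then q.-1 else q.
Proof. by case: p => //= p; rewrite /block /=; case: (boolP (odd p)) => /=; lia. Qed.

Lemma cell_lt k i j : i < t -> j < t -> cell k i j < t ^ 2.
Proof.
by case: Mbal => Mlt _ _ lti ltj; have := Mlt i j lti ltj; rewrite /cell; case: ifP; lia.
Qed.

Lemma lex_label_inj k i j k' i' j' :
  k < q -> i < t -> j < t -> k' < q -> i' < t -> j' < t ->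
  lex_label k i j = lex_label k' i' j' -> [/\ k = k', i = i' & j = j'].
Proof.
case: Mbal => Mlt Minj _ ltk lti ltj ltk' lti' ltj'.
case/(eqn_divmod (cell_lt _ lti ltj) (cell_lt _ lti' ltj')).
move/(block_inj ltk ltk') => <-; rewrite /cell => cellE.
suff /(Minj _ _ _ _ lti ltj lti' ltj')[-> ->] : M i j = M i' j' by [].
by move: cellE (Mlt _ _ lti ltj) (Mlt _ _ lti' ltj'); case: ifP => _; lia.
Qed.

Lemma lex_label_lt k i j : k < q -> i < t -> j < t ->
  lex_label k i j < q * t ^ 2.
Proof.
move=> ltk lti ltj; have := block_lt ltk; have := cell_lt k lti ltj.
rewrite /lex_label; nia.
Qed.

Definition row_sum k i := \sum_(j < t) (lex_label k i j).+1.
Definition col_sum k j := \sum_(i < t) (lex_label k i j).+1.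

Lemma cell_sum p i j : 0 < p -> i < t -> j < t ->
  cell p.-1 i j + cell p i j = (t ^ 2).-1.
Proof.
case: p => //= p _ lti ltj; have [/(_ i j lti ltj) + _ _] := Mbal.
by rewrite /cell /=; case: (odd p) => /=; lia.
Qed.

(** Complementary cells and the two successors give t^2 + 1, so the factor of t^2 is one more than
    the sum of the two blocks. *)
Lemma label_pair_sum p i j : 0 < p < q -> i < t -> j < t ->
  (lex_label p.-1 i j).+1 + (lex_label p i j).+1 =
  (t ^ 2 * (if odd p then q else q.+1)).+1.
Proof.
move=> pq lti ltj; have /andP[p0 _] := pq.
have := block_sum pq; have := cell_sum p0 lti ltj.
rewrite /lex_label => cE bE.
have t2 : 0 < t ^ 2 by nia.
transitivity ((block p.-1 + block p) * t ^ 2 + (cell p.-1 i j + cell p i j) + 2).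
  by lia.
by rewrite cE bE; case: ifP => _; nia.
Qed.

Lemma row_pair_sum p i : 0 < p < q -> i < t ->
  row_sum p.-1 i + row_sum p i = t * (t ^ 2 * (if odd p then q else q.+1)).+1.
Proof.
move=> pq lti; rewrite -big_split /=.
rewrite (eq_bigr _ (fun j _ => label_pair_sum pq lti (ltn_ord j))).
by rewrite sum_nat_const card_ord.
Qed.

Lemma col_pair_sum p j : 0 < p < q -> j < t ->
  col_sum p.-1 j + col_sum p j = t * (t ^ 2 * (if odd p then q else q.+1)).+1.
Proof.
move=> pq ltj; rewrite -big_split /=.
rewrite (eq_bigr _ (fun i _ => label_pair_sum pq (ltn_ord i) ltj)).
by rewrite sum_nat_const card_ord.
Qed.

(** As [q] is odd, the first and the last block both carry [M] itself, with weights 0 and (q-1)/2;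
    the balance of [M] removes the dependence on [i]. *)
Lemma end_pair_sum i : i < t ->
  row_sum 0 i + col_sum q.-1 i = t * (t ^ 2 * q./2.+1).+1.
Proof.
move=> lti; rewrite -big_split /=.
have [Mlt _ Msum] := Mbal.
rewrite (eq_bigr (fun j : 'I_t => (q./2 * t ^ 2 + 2) + (M i j + M j i))); last first.
  move=> j _; rewrite /lex_label /block /cell /=.
  have -> : odd q.-1 = false by lia.
  have -> : q.-1./2 = q./2 by lia.
  lia.
rewrite big_split /= Msum // sum_nat_const card_ord.
have t2 : 0 < t ^ 2 by nia.
by rewrite -mulnDr; congr (_ * _); nia.
Qed.

Lemma lex_trail_labeling :
  exists f : {set lex_product G (edgeless t)} -> nat, edge_labeling f /\
  forall (u : G) (i : 'I_t), vertex_sum f (u, i) =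
    (x 0 == u) * row_sum 0 i + (x q == u) * col_sum q.-1 i +
    \sum_(1 <= p < q) (x p == u) * (t * (t ^ 2 * (if odd p then q else q.+1)).+1).
Proof.
pose P := lex_product G (edgeless t).
pose em (z : 'I_q * ('I_t * 'I_t)) : {set P} :=
  [set (row_end z.1, z.2.1); (col_end z.1, z.2.2)].
pose l (z : 'I_q * ('I_t * 'I_t)) := lex_label z.1 z.2.1 z.2.2.
have ends_neq k : k < q -> (row_end k == col_end k) = false.
  by move=> /adj_ends; case: eqP => // ->; rewrite adj_irr.
have em_inj : injective em.
  move=> [k [i j]] [k' [i' j']] /set2_eq[] [] [E1 Ei] [E2 Ej].
    by rewrite Ei Ej (ord_inj (ends_inj (ltn_ord k) (ltn_ord k') E1 E2)).
  by case: (ends_noswap (ltn_ord k) (ltn_ord k') E1).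
have adjP k (i j : 'I_t) : k < q ->
    adj ((row_end k, i) : P) ((col_end k, j) : P).
  by move=> ltk; rewrite /= /lex_adj /= adj_ends.
have em_onto e : e \in edges P <-> exists z, e = em z.
  split=> [/edgesP[[u i] [[v j] [+ ->]]]|[[k [i j]] ->]]; last exact/adj_edge/adjP.
  rewrite /= /lex_adj /= andbF orbF => /ends_onto[k ltk [] [-> ->]].
    by exists (Ordinal ltk, (i, j)).
  by exists (Ordinal ltk, (j, i)); rewrite setUC.
have l_inj : injective l.
  move=> [k [i j]] [k' [i' j']] E.
  have [] := lex_label_inj (ltn_ord k) (ltn_ord i) (ltn_ord j)
                           (ltn_ord k') (ltn_ord i') (ltn_ord j') E.
  by move=> /ord_inj-> /ord_inj-> /ord_inj->.
have l_lt z : l z < #|{: 'I_q * ('I_t * 'I_t)}|.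
  by rewrite !card_prod !card_ord mulnn lex_label_lt.
have [f [labf sumf]] := edge_labeling_of_param em_inj em_onto l_inj l_lt.
exists f; split=> // u i; rewrite sumf big_mkcond /=.
(* Copy [i] of the vertex at position [p] meets the neighboring blocks in their row [i] if [p] is
   even, in their column [i] if [p] is odd. *)
pose D p k := if odd p then col_sum k i else row_sum k i.
transitivity (\sum_(k < q) ((x k == u) * D k k + (x k.+1 == u) * D k.+1 k)).
  rewrite -(pair_bigA _ (fun k z => if (u, i) \in em (k, z) then (l (k, z)).+1 else 0)).
  apply: eq_bigr => k _.
  rewrite -(pair_bigA _ (fun i' j' =>
    if (u, i) \in em (k, (i', j')) then (l (k, (i', j'))).+1 else 0)) /=.
  transitivity ((row_end k == u) * row_sum k i + (col_end k == u) * col_sum k i).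
    have memE i' j' : ((u, i) \in em (k, (i', j'))) =
        ((row_end k == u) && (i' == i)) || ((col_end k == u) && (j' == i)).
      by rewrite !inE !xpair_eqE !(eq_sym u) !(eq_sym i).
    under eq_bigr do under eq_bigr do rewrite memE.
    have [ru|_] /= := eqVneq (row_end k) u.
      have -> /= : (col_end k == u) = false by rewrite -ru eq_sym ends_neq.
      rewrite mul1n mul0n addn0 (bigD1 i) //= eqxx [X in _ + X]big1 ?addn0 //.
      by move=> i' /negPf ->; rewrite big1.
    case: eqP => _ /=; last by rewrite big1 // => i' _; rewrite big1.
    rewrite exchange_big /= (bigD1 i) //= eqxx [X in _ + X]big1 ?addn0 ?mul1n //.
    by move=> i' /negPf ->; rewrite big1.
  by rewrite /row_end /col_end /D /=; case: (odd k); rewrite //= addnC.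
rewrite (sum_shift (fun p => (x p == u) * D p p) (fun p => (x p == u) * D p p.-1)).
  rewrite /D /= odd_q -addnA (addnC (\sum_(_ <= _ < _) _)) addnA; congr (_ + _).
  apply: eq_big_nat => p pq; rewrite -mulnDr addnC; congr (_ * _).
  by case: ifP => op; rewrite ?row_pair_sum ?col_pair_sum ?op.
by case: q odd_q.
Qed.
End LexLabeling.

Lemma nth_walk_edges (G : sgraph) (s : G) p k : k < size p ->
  nth set0 (walk_edges s p) k = [set nth s (s :: p) k; nth s (s :: p) k.+1].
Proof. by move=> ltk; rewrite (nth_pairmap s). Qed.

(** The two ends of an edge differ, so membership is a sum of two indicators; this is the shape that
    [sum_shift] regroups. *)
Lemma count_walk_edges (G : sgraph) (s : G) p u : path (@adj G) s p ->
  count (fun e : {set G} => u \in e) (walk_edges s p) =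
  \sum_(k < size p) ((nth s (s :: p) k == u) + (nth s (s :: p) k.+1 == u)).
Proof.
elim: p s => [|v p IHp] s /=; first by rewrite big_ord0.
case/andP=> sv pp; rewrite big_ord_recl /= IHp // !inE !(eq_sym u); congr (_ + _).
  have : s != v by apply: contraTneq sv => ->; rewrite adj_irr.
  by case: (eqVneq s u) => [->|_] //; rewrite eq_sym => /negPf ->.
apply: eq_bigr => k _; have ltk := ltn_ord k; rewrite add0n.
have -> : nth v (v :: p) k = nth s (v :: p) k by apply/set_nth_default/ltnW.
by have -> : nth v (v :: p) k.+1 = nth s p k by apply: set_nth_default.
Qed.

(** * Splitting the hub w *)

Section SplitGraph.
Variables (G : sgraph) (w : G) (V2 : {set G}).
Hypothesis w_notin : w \notin V2.
Hypothesis indep_in : forall u v, u \in V2 -> v \in V2 -> ~~ adj u v.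
Hypothesis indep_out : forall u v, u != w -> v != w ->
  u \notin V2 -> v \notin V2 -> ~~ adj u v.

(* [Some w] keeps the edges from w to V2, and [None] is a second copy of w that
   takes over the edges from w to V3.  The result is bipartite, with
   {Some w} U V3 on the side [true] and V2 U {None} on the side [false]. *)
Definition side (h : option G) := if h is Some x then x \notin V2 else false.

Definition unsplit (h : option G) := odflt w h.

Definition split_adj : rel (option G) :=
  fun h h' => adj (unsplit h) (unsplit h') && (side h != side h').

Fact split_adj_sym : symmetric split_adj.
Proof. by move=> h h'; rewrite /split_adj adj_sym eq_sym. Qed.

Fact split_adj_irr : irreflexive split_adj.
Proof. by move=> h; rewrite /split_adj eqxx andbF. Qed.

Definition split_graph : sgraph := SGraph split_adj_sym split_adj_irr.

(** Only [w] has two copies, and they lie on different sides. *)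
Lemma unsplit_inj h h' : unsplit h = unsplit h' -> side h = side h' -> h = h'.
Proof.
case: h h' => [u|] [v|] //=; first by move=> ->.
  by move=> ->; rewrite w_notin.
by move=> <-; rewrite w_notin.
Qed.

Lemma unsplit_swap h h' : unsplit h = unsplit h' -> side h -> ~~ side h' ->
  unsplit h = w.
Proof. by case: h h' => [u|] [v|] //= ->; case: (v \in V2). Qed.

(** The neighbors of [h] all lie on the opposite side, where [unsplit] is injective, so they can be
    counted in [G]. *)
Lemma split_degree (h : split_graph) : degree h =
  #|[set u | adj (unsplit h) u & if side h then (u \in V2) || (u == w) else u \notin V2]|.
Proof.
rewrite /degree -(@card_in_imset _ _ unsplit); last first.
  move=> h1 h2; rewrite !inE => /andP[_ s1] /andP[_ s2] E.
  by apply: unsplit_inj => //; move: s1 s2; do 3!case: side.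
apply: eq_card => u; rewrite inE; apply/imsetP/andP => [[h']|[uadj]].
  rewrite inE => /andP[ha hs] ->; split=> //; move: hs.
  case: (side h); case: h' {ha} => [v|] //=; rewrite ?eqxx ?orbT //.
    by case: (v \in V2).
  by case: (v \in V2).
case: ifP => sh.
  case/orP=> [uV|/eqP uw].
    by exists (Some u); rewrite // inE /= /split_adj /= uadj sh uV.
  by exists None; rewrite // inE /= /split_adj /= -uw uadj sh.
by move=> uV; exists (Some u); rewrite // inE /= /split_adj /= uadj sh uV.
Qed.

Lemma split_degree_Some u : u != w -> degree (Some u : split_graph) = degree u.
Proof.
move=> uw; rewrite split_degree; apply: eq_card => v; rewrite !inE /=.
apply: andb_idr => uv; case: ifPn => [uV|/negbNE uV].
  by apply: contraTT uv; rewrite negb_or => /andP[vV vw]; apply: indep_out.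
by apply: contraTN uv => vV; apply: indep_in.
Qed.

Lemma split_degree_hub : degree (Some w : split_graph) = #|neighbors w :&: V2|.
Proof.
rewrite split_degree; apply: eq_card => v; rewrite !inE /= w_notin.
by apply: andb_id2l; case: eqP => [->|_ _]; rewrite ?adj_irr ?orbF.
Qed.

Lemma split_degree_None :
  degree (None : split_graph) = #|neighbors w :\: V2|.
Proof. by rewrite split_degree; apply: eq_card => v; rewrite !inE andbC. Qed.

Lemma split_connected : connected_graph G -> forall h : split_graph,
  connect (@adj split_graph) (Some w) h || connect (@adj split_graph) None h.
Proof.
move=> conn [v|]; last by rewrite connect0 orbT.
(* A path of [G] may enter [w] by one copy and leave by the other. Counting [w] itself as reached
   lets the path restart there from the copy that fits. *)
pose reach v := (v == w) ||
  (connect (@adj split_graph) (Some w) (Some v) ||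
   connect (@adj split_graph) None (Some v)).
suff : reach v by rewrite /reach => /predU1P[->|//]; rewrite connect0.
have clos : closed (@adj G) [pred v | reach v].
  apply: intro_closed => [|u {}v uv]; first exact/sym_connect_sym/adj_sym.
  rewrite !inE {2}/reach; have [//|vw /=] := eqVneq v w.
  have [uw _|uw] := eqVneq u w.
    have wv : adj w v by rewrite -uw.
    have [vV|vV] := boolP (v \in V2).
      by rewrite connect1 //= /split_adj /= wv w_notin vV.
    by rewrite orbC connect1 //= /split_adj /= wv vV.
  rewrite /reach (negPf uw) /=.
  have uv1 : connect (@adj split_graph) (Some u) (Some v).
    apply: connect1; rewrite /= /split_adj /= uv /=.
    apply: contraTneq uv => sE.
    have [uV|uV] := boolP (u \in V2).
      by apply: indep_in => //; move: sE; rewrite uV; case: (v \in V2).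
    by apply: indep_out => //; move: sE; rewrite uV; case: (v \in V2).
  by case/orP=> c; rewrite (connect_trans c uv1) ?orbT.
by have := closed_connect clos (conn w v); rewrite !inE /reach eqxx => <-.
Qed.

(** Some endpoint lies outside [V2] while the other is in [V2] or equals [w]. The former is taken as
    [Some]; the latter becomes [None] when it is [w]. *)
Lemma split_edge_cover u v : adj u v -> exists h h',
  [/\ split_adj h h', side h, ~~ side h' &
    (u = unsplit h /\ v = unsplit h') \/ (v = unsplit h /\ u = unsplit h')].
Proof.
have cover_out x y : adj x y -> x \notin V2 -> y \in V2 \/ y = w -> exists h h',
    [/\ split_adj h h', side h, ~~ side h' & x = unsplit h /\ y = unsplit h'].
  move=> xy xV [yV|yw]; [exists (Some x), (Some y)|exists (Some x), None].
    by rewrite /split_adj /= xy xV yV.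
  by rewrite /split_adj /= -yw xy xV.
have out_in x y : adj x y -> x \notin V2 -> y \notin V2 -> x != w -> y = w.
  move=> xy xV yV xw; apply/eqP/negPn/negP => yw.
  by have := indep_out xw yw xV yV; rewrite xy.
move=> uv; have vu : adj v u by rewrite adj_sym.
suff [[uV vE]|[vV uE]] : (u \notin V2 /\ (v \in V2 \/ v = w)) \/
    (v \notin V2 /\ (u \in V2 \/ u = w)).
- by have [h [h' [? ? ? ?]]] := cover_out _ _ uv uV vE; exists h, h'; split=> //; left.
- by have [h [h' [? ? ? ?]]] := cover_out _ _ vu vV uE; exists h, h'; split=> //; right.
have [uV|uV] := boolP (u \in V2); have [vV|vV] := boolP (v \in V2); try by auto.
  by have := indep_in uV vV; rewrite uv.
have [uw|uw] := eqVneq u w; first by right; auto.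
by left; split=> //; right; apply: out_in uv _ _ _.
Qed.

Variables (a b : nat).
Hypothesis deg_hub : degree (Some w : split_graph) = a.*2.+1.
Hypothesis deg_None : degree (None : split_graph) = b.*2.+1.
Hypothesis even_degree : forall u, u != w -> ~~ odd (degree u).
Hypothesis conn : connected_graph G.

Lemma split_trail : exists q (h : nat -> option G),
  [/\ h 0 = Some w, h q = None,
      forall k, k < q -> split_adj (h k) (h k.+1),
      forall k k', k < q -> k' < q ->
        [set h k; h k.+1] = [set h k'; h k'.+1] -> k = k' &
      forall g g', split_adj g g' -> exists2 k, k < q & [set g; g'] = [set h k; h k.+1]]
  /\ forall g : split_graph, degree g = \sum_(k < q) ((h k == g) + (h k.+1 == g)).
Proof.
have [||| p [pp lp up covp]] := @euler_trail split_graph (Some w) None.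
- by rewrite deg_hub /= odd_double.
- case=> [u|]; rewrite ?eqxx ?orbT //; have [->|uw] := eqVneq u w.
    by rewrite eqxx.
  by rewrite split_degree_Some // (negPf (even_degree uw)).
- exact: split_connected.
have sz : size (walk_edges (Some w : split_graph) p) = size p by rewrite size_pairmap.
pose h k : option G := nth (Some w) (Some w :: p) k.
have hE k : k < size p -> [set h k; h k.+1] =
    nth set0 (walk_edges (Some w : split_graph) p) k.
  by move=> ltk; rewrite nth_walk_edges.
exists (size p), h; split; [split|].
- by [].
- by rewrite /h nth_last.
- by move=> k; move/(pathP (Some w)): pp => /(_ k).
- move=> k k' ltk ltk'.
  rewrite !hE // => /eqP.
  by rewrite nth_uniq ?sz // => /eqP.
- move=> g g' /(@adj_edge split_graph); rewrite -covp => /(nthP set0)[k].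
  by rewrite sz => ltk <-; exists k; rewrite ?hE.
move=> g; rewrite -count_walk_edges //.
apply: degree_covered up _ => [|v gv]; first exact: walk_edges_sub.
by rewrite covp adj_edge.
Qed.


Variables (t : nat) (M : nat -> nat -> nat).
Hypothesis Mbal : balanced_square t M.

Lemma split_labeling : exists q (f : {set lex_product G (edgeless t)} -> nat),
  [/\ edge_labeling f,
      forall u, u != w -> u \in V2 -> b.*2.+1 + degree u <= q,
      forall u, u != w -> u \notin V2 -> a.*2.+1 + degree u <= q,
      forall (u : G) (i : 'I_t), u != w -> vertex_sum f (u, i) =
        (degree u)./2 * (t * (t ^ 2 * (if u \in V2 then q else q.+1)).+1) &
      forall i : 'I_t, vertex_sum f (w, i) =
        t * (t ^ 2 * q./2.+1).+1 + a * (t * (t ^ 2 * q.+1).+1) +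
        b * (t * (t ^ 2 * q).+1)] /\ odd q.
Proof.
have [q [h [[h0 hq hadj hinj honto] hdeg]]] := split_trail.
(* Sides alternate along the trail, so the side of a vertex fixes the parity of its positions; the
   ends lie on different sides, hence [q] is odd. *)
have sideh k : k <= q -> side (h k) = ~~ odd k.
  elim: k => [_|k IHk ltk]; first by rewrite h0.
  have /andP[_] := hadj k ltk; rewrite (IHk (ltnW ltk)) /=.
  by case: (odd k); case: (side _).
have oddq : odd q by have := sideh q (leqnn q); rewrite hq /=; case: (odd q).
pose x k := unsplit (h k).
pose hr k := if odd k then h k.+1 else h k.
pose hc k := if odd k then h k else h k.+1.
have rowE k : row_end x k = unsplit (hr k) by rewrite /row_end /hr; case: ifP.
have colE k : col_end x k = unsplit (hc k) by rewrite /col_end /hc; case: ifP.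
have side_hr k : k < q -> side (hr k).
  move=> ltk; rewrite /hr; case: ifP => ok; rewrite sideh ?(ltnW ltk) //= ok //.
have side_hc k : k < q -> ~~ side (hc k).
  move=> ltk; rewrite /hc; case: ifP => ok; rewrite sideh ?(ltnW ltk) //= ok //.
have hrcE k : [set hr k; hc k] = [set h k; h k.+1].
  by rewrite /hr /hc; case: ifP => //; rewrite setUC.
have adj_ends k : k < q -> adj (row_end x k) (col_end x k).
  move=> ltk; rewrite rowE colE; have /andP[+ _] := hadj k ltk.
  by rewrite /hr /hc; case: ifP => // _; rewrite adj_sym.
have ends_inj k k' : k < q -> k' < q ->
    row_end x k = row_end x k' -> col_end x k = col_end x k' -> k = k'.
  move=> ltk ltk'; rewrite !rowE !colE => Er Ec.
  have {}Er : hr k = hr k' by apply: unsplit_inj; rewrite ?side_hr.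
  have {}Ec : hc k = hc k'.
    by apply: unsplit_inj; rewrite ?(negPf (side_hc _ _)).
  by apply: (hinj _ _ ltk ltk'); rewrite -hrcE -(hrcE k') Er Ec.
(* A swap would identify vertices of opposite sides at both endpoints, so both would be [w], which
   is not adjacent to itself. *)
have ends_noswap k k' : k < q -> k' < q ->
    row_end x k = col_end x k' -> col_end x k <> row_end x k'.
  move=> ltk ltk' E1 E2; have := adj_ends k ltk.
  rewrite E2 E1; rewrite rowE colE in E1; rewrite rowE colE in E2.
  rewrite colE -E1 rowE -E2 (unsplit_swap E1) ?side_hr ?side_hc //.
  by rewrite E2 (unsplit_swap (esym E2)) ?side_hr ?side_hc // adj_irr.
have ends_onto u v : adj u v -> exists2 k, k < q &
    (u = row_end x k /\ v = col_end x k) \/ (v = row_end x k /\ u = col_end x k).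
  case/split_edge_cover=> g [g' [gg' sg sg' uvE]].
  have [k ltk] := honto g g' gg'; rewrite -(hrcE k) => /set2_eq E.
  exists k; rewrite // rowE colE.
  case: E => [[<- <-]|[E _]]; first exact: uvE.
  by have := side_hc k ltk; rewrite -E sg.
have [f [labf sumf]] :=
  lex_trail_labeling oddq Mbal adj_ends ends_inj ends_noswap ends_onto.
(* Inner visits take two edges each. As the trail also starts at [Some w] and ends at [None], the
   degrees 2a+1 and 2b+1 leave [a] and [b] inner visits. *)
pose N (g : option G) := \sum_(1 <= p < q) (h p == g).
have q_gt0 : 0 < q := odd_gt0 oddq.
have degN (g : split_graph) : degree g = (h 0 == g) + 2 * N g + (h q == g).
  rewrite hdeg (sum_shift (fun p => nat_of_bool (h p == g))
                          (fun p => nat_of_bool (h p == g))) //.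
  by rewrite big_split /= addnn -mul2n.
(* Distinct vertices of the same side share no edge, and the trail has [q] edges in all. *)
have bound (g g' : split_graph) : g != g' -> side g = side g' ->
    degree g + degree g' <= q.
  move=> gg' sgg'; rewrite !hdeg -big_split -[q in _ <= q]card_ord -sum1_card.
  apply: leq_sum => k _; have /andP[_] := hadj k (ltn_ord k).
  rewrite /= addnACA; set y := h k; set z := h k.+1 => yz.
  have one v : (v == g) + (v == g') <= (side v == side g).
    case: (eqVneq v g) => [->|_]; first by rewrite (negPf gg') eqxx.
    by case: (eqVneq v g') => [->|_]; rewrite ?sgg' ?eqxx.
  apply: leq_trans (leq_add (one y) (one z)) _.
  by move: yz; case: (side y); case: (side z); case: (side g).
have Nw : N (Some w) = a.
  by have := degN (Some w); rewrite deg_hub h0 hq eqxx /=; lia.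
have NN : N None = b.
  by have := degN None; rewrite deg_None h0 hq eqxx /=; lia.
have Nu u : u != w -> N (Some u) = (degree u)./2.
  move=> uw; have := degN (Some u); rewrite split_degree_Some // h0 hq.
  by rewrite (inj_eq (@Some_inj _)) eq_sym (negPf uw) /=; lia.
pose c p := t * (t ^ 2 * (if odd p then q else q.+1)).+1.
pose cside s := t * (t ^ 2 * (if s then q.+1 else q)).+1.
have sumN (g : option G) : \sum_(1 <= p < q) (h p == g) * c p = N g * cside (side g).
  rewrite /N big_distrl /=; apply: eq_big_nat => p /andP[_ ltp].
  case: eqP => [<-|]; rewrite ?mul0n // /c /cside sideh ?(ltnW ltp) //.
  by case: (odd p).
exists q, f; split=> //; split=> //.
- move=> u uw uV; rewrite -deg_None -split_degree_Some //.
  by apply: bound; rewrite //= uV.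
- move=> u uw uV; rewrite -deg_hub -split_degree_Some //.
  by apply: bound; rewrite /= ?w_notin ?uV // eq_sym (inj_eq (@Some_inj _)).
- move=> u i uw; rewrite sumf /x h0 hq /= eq_sym (negPf uw) !mul0n !add0n -Nu //.
  have -> : t * (t ^ 2 * (if u \in V2 then q else q.+1)).+1 = cside (side (Some u)).
    by rewrite /cside /=; case: (u \in V2).
  rewrite -sumN; apply: eq_big_nat => p _.
  by case: (h p) => [v|] /=; rewrite ?(inj_eq (@Some_inj _)) // eq_sym (negPf uw).
move=> i; rewrite sumf /x h0 hq /= eqxx !mul1n end_pair_sum // -addnA; congr (_ + _).
rewrite -[a in RHS]Nw -[b in RHS]NN.
have -> : N (Some w) * (t * (t ^ 2 * q.+1).+1) = N (Some w) * cside (side (Some w)).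
  by rewrite /= w_notin.
rewrite -[t * _]/(cside (side None)) -!sumN -big_split; apply: eq_big_nat => p _.
by case: (h p) => [v|] /=; rewrite ?(inj_eq (@Some_inj _)) ?addn0 // eqxx.
Qed.

End SplitGraph.

(** * The three colors *)

Section ColorSums.
Variables (t q : nat).
Hypothesis t_gt0 : 0 < t.

(** The contribution of two matched blocks to a vertex: q' is q at a visit of [V2] or [None], q+1 at
    a visit of [V3] or [Some w], and (q+1)/2 for the two ends of the trail together. *)
Definition color_sum q' := t * (t ^ 2 * q').+1.

(* t^2 q + 1 is coprime to t^2. *)
Lemma color_sum_neq m n : 0 < n -> 2 * n <= q ->
  m * color_sum q <> n * color_sum q.+1.
Proof.
move=> n0 nq E.
have {E} : m * (t ^ 2 * q).+1 = n * (t ^ 2 * q.+1).+1.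
  by apply/eqP; rewrite -(eqn_pmul2l t_gt0) !(mulnCA t); apply/eqP.
have T0 : 0 < t ^ 2 by rewrite expn_gt0 t_gt0.
move: (t ^ 2) T0 => T T0 E.
have dvd : (T * q).+1 %| n * T.
  rewrite -(dvdn_addr _ (dvdn_mull n (dvdnn _))).
  by have <- : m * (T * q).+1 = n * (T * q).+1 + n * T; [rewrite E; nia|rewrite dvdn_mull].
have : (T * q).+1 %| n.
  rewrite Gauss_dvdl // in dvd.
  by rewrite /coprime -addn1 gcdnC mulnC gcdnMDl gcdn1.
by move/(dvdn_leq n0); nia.
Qed.

(* Modulo t^2 q + 1, the left side over t is t^2 (a + (q+1)/2) + 1, not 0. *)
Lemma hub_sum_neq_odd a b m : odd q -> 2 * a + 3 <= q ->
  color_sum q./2.+1 + a * color_sum q.+1 + b * color_sum q <> m * color_sum q.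
Proof.
move=> oq aq E.
have T0 : 0 < t ^ 2 by rewrite expn_gt0 t_gt0.
have {E} : m * (t ^ 2 * q).+1 + 0 =
    (a + b) * (t ^ 2 * q).+1 + (t ^ 2 * (a + q./2.+1)).+1.
  apply/eqP; rewrite -(eqn_pmul2l t_gt0); apply/eqP.
  by move: E; rewrite /color_sum; nia.
case/eqn_divmod => //; rewrite ltnS ltn_pmul2l //; lia.
Qed.

(** Modulo t^2 (q+1) + 1, each t^2 q + 1 is -t^2, so the left side over t leaves t^2 ((q+1)/2 - b) +
    1, strictly between 0 and the modulus. *)
Lemma hub_sum_neq_even a b n : odd q -> 2 * b + 1 <= q ->
  color_sum q./2.+1 + a * color_sum q.+1 + b * color_sum q <> n * color_sum q.+1.
Proof.
move=> oq bq E.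
have T0 : 0 < t ^ 2 by rewrite expn_gt0 t_gt0.
have {E} : n * (t ^ 2 * q.+1).+1 + 0 =
    (a + b) * (t ^ 2 * q.+1).+1 + (t ^ 2 * (q./2.+1 - b)).+1.
  have [r rE] : exists r, q./2.+1 = b + r by exists (q./2.+1 - b); lia.
  apply/eqP; rewrite -(eqn_pmul2l t_gt0); apply/eqP.
  by move: E; rewrite /color_sum rE addKn; nia.
case/eqn_divmod => //; rewrite ltnS ltn_pmul2l //; lia.
Qed.

End ColorSums.

(** * The lower bound and the final count of colors *)

Lemma chromatic_lower_bound (G : sgraph) t k j : 0 < t ->
  is_chromatic_number G k ->
  (exists f : {set lex_product G (edgeless t)} -> nat,
     local_antimagic f /\ num_colors f = j) -> k <= j.
Proof.
move=> t0 [_ kmin] [f [[_ anti] fj]]; apply: kmin; rewrite -fj.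
pose i0 : edgeless t := Ordinal t0.
pose sums := undup [seq vertex_sum f z | z : lex_product G (edgeless t)].
have mem_sums u : vertex_sum f (u, i0) \in sums.
  by rewrite mem_undup map_f // mem_enum.
have lt_sums u : index (vertex_sum f (u, i0)) sums < size sums.
  by rewrite index_mem.
exists (fun u => Ordinal (lt_sums u)) => u v uv.
apply/eqP => -[/(congr1 (nth 0 sums))]; rewrite !nth_index //.
by apply: anti; rewrite /= /lex_adj /= uv.
Qed.

Theorem theorem2p14 (G : sgraph) (w : G) (V1 V2 V3 : {set G})
    (a b m n : nat)
    (hconn : connected_graph G)
    (hchi : is_chromatic_number G 3)
    (hcover : V1 :|: V2 :|: V3 = [set: G])
    (hdisj12 : [disjoint V1 & V2])
    (hdisj13 : [disjoint V1 & V3])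
    (hdisj23 : [disjoint V2 & V3])
    (hind1 : independent V1)
    (hind2 : independent V2)
    (hind3 : independent V3)
    (hV1 : V1 = [set w])
    (hV2 : 2 <= #|V2|)
    (hV3 : 2 <= #|V3|)
    (hw2 : #|neighbors w :&: V2| = 2 * a + 1)
    (hw3 : #|neighbors w :&: V3| = 2 * b + 1)
    (hm : 0 < m)
    (hn : 0 < n)
    (hdeg2 : forall u : G, u \in V2 -> degree u = 2 * m)
    (hdeg3 : forall v : G, v \in V3 -> degree v = 2 * n)
    (t : nat)
    (ht : 3 <= t) :
  is_local_antimagic_chromatic_number (lex_product G (edgeless t)) 3.
Proof.
have t_gt0 : 0 < t by apply: leq_trans ht.
split; last by move=> j; apply: chromatic_lower_bound t_gt0 hchi.
have w2 : w \notin V2 by rewrite (disjointFr hdisj12) // hV1 set11.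
have in3 u : (u \in V3) = (u != w) && (u \notin V2).
  have := in_setT u; rewrite -hcover hV1 !inE.
  have [->|_] := eqVneq u w; first by rewrite (disjointFr hdisj13) // hV1 set11.
  by case: (boolP (u \in V2)) => [/(disjointFr hdisj23)|].
have out3 u v : u != w -> v != w -> u \notin V2 -> v \notin V2 -> ~~ adj u v.
  by move=> uw vw u2 v2; apply: hind3; rewrite in3 ?uw ?vw.
have deg_hub : degree (Some w : split_graph w V2) = a.*2.+1.
  by rewrite split_degree_hub // hw2; lia.
have deg_None : degree (None : split_graph w V2) = b.*2.+1.
  rewrite split_degree_None // -addn1 -muln2 mulnC -hw3; apply: eq_card => u.
  rewrite !inE in3 andbC; apply: andb_id2l => wu.
  by have [E|] := eqVneq u w; rewrite // E adj_irr in wu.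
have even_deg u : u != w -> ~~ odd (degree u).
  move=> uw; have [u2|u2] := boolP (u \in V2).
    by rewrite hdeg2 // mul2n odd_double.
  by rewrite hdeg3 ?in3 ?uw // mul2n odd_double.
have [M Mbal] := balanced_squareP ht.
have [q [f [[labf bound2 bound3 sumf sumw] oddq]]] :=
  split_labeling w2 hind2 out3 deg_hub deg_None even_deg hconn Mbal.
have [u2 u2V] : exists u, u \in V2 by apply/set0Pn; rewrite -card_gt0 ltnW.
have [u3 u3V] : exists u, u \in V3 by apply/set0Pn; rewrite -card_gt0 ltnW.
have notw2 u : u \in V2 -> u != w by apply: contraTneq => ->.
have sum2 u i : u \in V2 -> vertex_sum f (u, i) = m * color_sum t q.
  by move=> uV; rewrite sumf ?notw2 // uV hdeg2 // mul2n doubleK.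
have sum3 u i : u \in V3 -> vertex_sum f (u, i) = n * color_sum t q.+1.
  move=> uV; have := uV; rewrite in3 => /andP[uw /negPf u2'].
  by rewrite sumf // u2' hdeg3 // mul2n doubleK.
have b2 : b.*2.+1 + 2 * m <= q by rewrite -(hdeg2 _ u2V) bound2 ?notw2.
have b3 : a.*2.+1 + 2 * n <= q.
  rewrite -(hdeg3 _ u3V); move: u3V; rewrite in3 => /andP[*].
  exact: bound3.
pose c1 := color_sum t q./2.+1 + a * color_sum t q.+1 + b * color_sum t q.
pose c2 := m * color_sum t q; pose c3 := n * color_sum t q.+1.
(* The size conditions on [q] come from the degree bounds: [b3] gives 2a+3 <= q, as n > 0, and 2n <=
   q, while [b2] gives 2b+1 <= q. *)
have c12 : c1 <> c2 by apply: hub_sum_neq_odd => //; lia.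
have c13 : c1 <> c3 by apply: hub_sum_neq_even => //; lia.
have c23 : c2 <> c3 by apply: color_sum_neq => //; lia.
have sum1 i : vertex_sum f (w, i) = c1 by exact: sumw.
have classes u : [\/ u = w, u \in V2 | u \in V3].
  have := in_setT u; rewrite -hcover hV1 !inE -orbA.
  by case/or3P => [/eqP ?|?|?]; [constructor 1|constructor 2|constructor 3].
exists f; split; [split=> //|].
- move=> [u i] [v j]; rewrite /= /lex_adj /= andbF orbF => uv.
  have [uE|uV|uV] := classes u; have [vE|vV|vV] := classes v.
  - by move: uv; rewrite uE vE adj_irr.
  - by rewrite uE sum1 sum2.
  - by rewrite uE sum1 sum3.
  - by rewrite vE sum1 sum2 // => /esym.
  - by have := hind2 _ _ uV vV; rewrite uv.
  - by rewrite (sum2 u i) // (sum3 v j).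
  - by rewrite vE sum1 sum3 // => /esym.
  - by rewrite (sum3 u i) // (sum2 v j) // => /esym.
  - by have := hind3 _ _ uV vV; rewrite uv.
rewrite /num_colors -[3]/(size [:: c1; c2; c3]).
have uniq_c : uniq [:: c1; c2; c3].
  by rewrite /= !inE !negb_or !andbT -andbA; apply/and3P; split; apply/eqP.
(* Exactly three values occur: [w], [u2] and [u3] witness them, and each vertex belongs to one of
   the three classes. *)
apply/eqP; rewrite -(uniq_size_uniq uniq_c) ?undup_uniq // => c.
pose i0 : 'I_t := Ordinal t_gt0.
rewrite mem_undup !in_cons in_nil orbF; apply/or3P/mapP => [|[[u i] _ ->]].
  case=> /eqP->.
  - by exists (w, i0); rewrite ?mem_enum ?sum1.
  - by exists (u2, i0); rewrite ?mem_enum ?sum2.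
  - by exists (u3, i0); rewrite ?mem_enum ?sum3.
have [->|uV|uV] := classes u.
- by constructor 1; rewrite sum1.
- by constructor 2; rewrite sum2.
- by constructor 3; rewrite sum3.
Qed.
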